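(* There is a strictly convex real Banach space $\mathcal{X}$ of density continuum such that for every uncountable regular cardinal $\kappa$ and every subset $\mathcal{Y}$ of the unit sphere of $\mathcal{X}$ of cardinality $\kappa$, there exist $\varepsilon>0$ and a subset $\mathcal{Y}'\subseteq\mathcal{Y}$ of cardinality $\kappa$ which is $(1-\varepsilon)$-concentrated.
   Context: The density of an infinite dimensional Banach space is the minimal cardinality of a norm dense subset. For $r>0$, a subset $\mathcal{Y}$ of a Banach space is $r$-concentrated if $\|y-y'\|\le r$ for any two distinct $y,y'\in\mathcal{Y}$. A norm is strictly convex if $\|x+y\|=\|x\|+\|y\|$ for nonzero $x,y$ implies $x=\lambda y$ for some $\lambda>0$. *)

(* Defs.v *)
From HB Require Import structures.
From mathcomp Require Import all_boot all_order all_algebra.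
From mathcomp Require Import all_classical all_reals all_analysis.
From mathcomp Require wochoice.

Set Implicit Arguments.
Unset Strict Implicit.
Unset Printing Implicit Defensive.

Import Order.TTheory GRing.Theory Num.Theory.
Import numFieldNormedType.Exports.

Local Open Scope classical_set_scope.
Local Open Scope card_scope.
Local Open Scope ring_scope.

(** Cardinals are represented by types: "[A] has cardinality [K]" is
    [A #= [set: K]]. *)

Definition card_lt (T U : Type) (A : set T) (B : set U) : Prop :=
  A #<= B /\ ~ (B #<= A).

(** [le] makes [K] isomorphic to the initial ordinal that is the cardinal of
    [K]: it is a well-order, all of whose proper initial segments have smaller
    cardinality than [K]. *)
Definition initial_well_order (K : Type) (le : rel K) : Prop :=
  wochoice.well_order le /\
  forall x : K, card_lt [set y | le y x /\ y <> x] [set: K].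

Definition cofinal (K : Type) (le : rel K) (C : set K) : Prop :=
  forall x : K, exists2 y, C y & le x y.

(** Regularity, cf(kappa) = kappa: every cofinal subset of the initial ordinal
    kappa has cardinality kappa.  The order [le] is unique up to isomorphism, so
    its existential quantification is harmless. *)
Definition regular_cardinal (K : Type) : Prop :=
  infinite_set [set: K] /\
  exists le : rel K, initial_well_order le /\
    forall C : set K, cofinal le C -> C #= [set: K].

Definition uncountable_cardinal (K : Type) : Prop := ~ countable [set: K].

Definition has_density (X : topologicalType) (K : Type) : Prop :=
  (exists D : set X, dense D /\ D #= [set: K]) /\
  (forall D : set X, dense D -> [set: K] #<= D).

Definition strictly_convex (R : realType) (X : normedModType R) : Prop :=
  forall x y : X, x != 0 -> y != 0 -> `|x + y| = `|x| + `|y| ->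
    exists2 lam : R, 0 < lam & x = lam *: y.

Definition concentrated (R : realType) (X : normedModType R) (r : R)
    (Y : set X) : Prop :=
  forall y y' : X, Y y -> Y y' -> y != y' -> `|y - y'| <= r.

Definition unit_sphere (R : realType) (X : normedModType R) : set X :=
  [set x | `|x| = 1].
Arguments unit_sphere {R} X.

(* Main.v *)
(** The space is that of Johnson and Lindenstrauss for the almost disjoint family
    of branches of the binary tree, i.e. the closure in l_infty of the span of
    c_0 and of the indicators of the branches, with the norm
    [sup |x_s| + (sum_s w_s x_s^2)^(1/2)].  The l_2 part makes it strictly convex
    and forces [sup |x_s| <= 1 - eta], with [eta > 0] depending on [x], on the unit
    sphere.  Up to a small error, [x] is a rational vector supported on finitely
    many nodes plus [sum_i q_i 1_(branch f_i)] with [q_i] rational.  If [x] and [y]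
    share these rational data and the initial segments separating their branches,
    then at each node beyond these segments at most one index [i] contributes, hence
    [|x_s - y_s|] is at most about [max_i |q_i|], while [x_s] and [y_s] are close on
    finitely many nodes carrying most of the weights.  So the sphere is a countable
    union of sets of diameter less than 1, and a
    regular uncountable cardinal concentrates on one of them. *)

Require Import Defs.
From HB Require Import structures.
From mathcomp Require Import all_boot all_order all_algebra.
From mathcomp Require Import all_classical all_reals all_analysis.
From mathcomp Require Import ring lra.

Import Order.TTheory GRing.Theory Num.Theory.
Import numFieldNormedType.Exports.

Local Open Scope classical_set_scope.
Local Open Scope card_scope.
Local Open Scope ring_scope.

(** * Weighted sums and the weighted l_2 norm on bounded sequences *)

Section WeightedSum.
Variable R : realType.
Implicit Types (x y z : nat -> R) (a b M : R).

(** Since 2/3^(s+1) = 1/3^s - 1/3^(s+1), the weights telescope: their total is 1 and the tail from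
    [N] on is 1/3^N. *)
Definition weight (s : nat) : R := 2 / 3 ^+ s.+1.

Definition wsum z : R := limn (series (fun s => weight s * z s)).

Definition bounded_by M z : Prop := forall s, `|z s| <= M.

Definition bounded_seq z : Prop := exists M, bounded_by M z.

Lemma weight_gt0 s : 0 < weight s.
Proof. by rewrite divr_gt0// exprn_gt0. Qed.

Lemma sum_weight m n : (m <= n)%N ->
  \sum_(m <= k < n) weight k = (3 ^+ m)^-1 - (3 ^+ n)^-1.
Proof.
move=> mn.
rewrite (eq_bigr (fun k => (- (3 ^+ k.+1)^-1) - (- (3 ^+ k)^-1 : R))).
  by rewrite telescope_sumr//; lra.
move=> k _; rewrite /weight exprS invfM.
have : (3 ^+ k : R) != 0 by rewrite expf_neq0.
by move=> ?; field.
Qed.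

Lemma wsum_cvg z : bounded_seq z -> cvgn (series (fun s => weight s * z s)).
Proof.
move=> [M zM]; apply: normed_cvg.
apply: (@series_le_cvg _ _ (fun s => geometric (M * (2 / 3)) (3^-1) s)).
- by move=> s; exact: normr_ge0.
- move=> s /=; rewrite mulr_ge0 ?exprn_ge0 ?mulr_ge0//.
  exact: le_trans (zM 0%N).
- move=> s /=; rewrite normrM gtr0_norm ?weight_gt0//.
  have -> : M * (2 / 3) * 3^-1 ^+ s = weight s * M.
    rewrite /weight exprS exprVn.
    have : (3 ^+ s : R) != 0 by rewrite expf_neq0.
    by move=> ?; field.
  by rewrite ler_wpM2l// ltW// weight_gt0.
- by apply: is_cvg_geometric_series; rewrite gtr0_norm; lra.
Qed.

Lemma wsumD x y : bounded_seq x -> bounded_seq y ->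
  wsum (fun s => x s + y s) = wsum x + wsum y.
Proof.
move=> bx by_; rewrite /wsum -lim_seriesD; try exact: wsum_cvg.
by congr (limn (series _)); apply/funext => s; rewrite /= mulrDr.
Qed.

Lemma wsumZ a x : bounded_seq x -> wsum (fun s => a * x s) = a * wsum x.
Proof.
move=> bx; rewrite /wsum -[RHS]/(a *: _) -lim_seriesZ; last exact: wsum_cvg.
by congr (limn (series _)); apply/funext => s; rewrite /= mulrCA.
Qed.

Lemma wsum_tail M z N : bounded_by M z ->
  `|wsum z - \sum_(0 <= k < N) weight k * z k| <= M * (3 ^+ N)^-1.
Proof.
move=> zM; have M0 : 0 <= M by exact: le_trans (zM 0%N).
have near_le : \forall n \near \oo,
    `|series (fun s => weight s * z s) n - \sum_(0 <= k < N) weight k * z k|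
    <= M * (3 ^+ N)^-1.
  exists N => // n /= Nn; rewrite /series /= (@big_cat_nat _ _ _ N)//=.
  rewrite addrAC subrr add0r.
  apply: (le_trans (ler_norm_sum _ _ _)).
  apply: (@le_trans _ _ (\sum_(N <= k < n) M * weight k)).
    apply: ler_sum => k _; rewrite normrM gtr0_norm ?weight_gt0// mulrC.
    by rewrite ler_wpM2r// ltW// weight_gt0.
  by rewrite -mulr_sumr sum_weight// ler_wpM2l// gerBl invr_ge0 exprn_ge0.
have zc : cvgn (series (fun s => weight s * z s)).
  by apply: wsum_cvg; exists M.
rewrite ler_distl; apply/andP; split.
  apply: limr_ge => //; apply: filterS near_le => n.
  by rewrite ler_distl => /andP[].
apply: limr_le => //; apply: filterS near_le => n.
by rewrite ler_distl => /andP[].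
Qed.

(** The first [N] weights have sum at most 1, and [wsum_tail] bounds the rest. This serves for
    sequences that are tiny on finitely many nodes and merely bounded elsewhere. *)
Lemma wsum_le_split a M z N : 0 <= a -> (forall s, (s < N)%N -> `|z s| <= a) ->
  bounded_by M z -> `|wsum z| <= a + M * (3 ^+ N)^-1.
Proof.
move=> a0 za zM; have := wsum_tail _ _ N zM.
set S := \sum_(_ <= _ < _) _ => h.
have Sa : `|S| <= a.
  apply: (le_trans (ler_norm_sum _ _ _)).
  apply: (@le_trans _ _ (\sum_(0 <= k < N) a * weight k)).
    rewrite !big_nat; apply: ler_sum => k kN.
    rewrite normrM gtr0_norm ?weight_gt0// mulrC.
    by rewrite ler_wpM2r ?za// ltW// weight_gt0.
  by rewrite -mulr_sumr sum_weight// expr0 invr1 ler_piMr// gerBl invr_ge0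
             exprn_ge0.
rewrite -[wsum z](subrK S) addrC.
by apply: (le_trans (ler_normD _ _)); rewrite lerD.
Qed.

Lemma wsum_le M z : bounded_by M z -> `|wsum z| <= M.
Proof.
(* Split at [N = 0] with [a = 0], so that the condition on initial entries is vacuous. *)
move=> zM; rewrite -[M]mulr1 -invr1 -(expr0 3) -[leRHS]add0r.
exact: wsum_le_split.
Qed.

Lemma wsum_ge_term z k : bounded_seq z -> (forall s, 0 <= z s) ->
  weight k * z k <= wsum z.
Proof.
move=> bz z0; apply: limr_ge; first exact: wsum_cvg.
exists k.+1 => // n /= kn; rewrite /series /= big_mkord.
rewrite (bigD1 (Ordinal kn))//= lerDl sumr_ge0// => i _.
by rewrite mulr_ge0// ltW// weight_gt0.
Qed.

Lemma wsum_ge0 z : bounded_seq z -> (forall s, 0 <= z s) -> 0 <= wsum z.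
Proof.
move=> bz z0; apply: le_trans (wsum_ge_term _ 0%N bz z0).
by rewrite mulr_ge0// ltW// weight_gt0.
Qed.

Lemma bounded_seqD x y : bounded_seq x -> bounded_seq y ->
  bounded_seq (fun s => x s + y s).
Proof.
move=> [a xa] [b yb]; exists (a + b) => s.
by apply: (le_trans (ler_normD _ _)); rewrite lerD.
Qed.

Lemma bounded_seqM x y : bounded_seq x -> bounded_seq y ->
  bounded_seq (fun s => x s * y s).
Proof.
by move=> [a xa] [b yb]; exists (a * b) => s; rewrite normrM ler_pM.
Qed.

Lemma bounded_seqZ a x : bounded_seq x -> bounded_seq (fun s => a * x s).
Proof. by apply: bounded_seqM; exists `|a|. Qed.

Definition wdot x y : R := wsum (fun s => x s * y s).

Definition wnorm x : R := Num.sqrt (wdot x x).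

Lemma wdotC x y : wdot x y = wdot y x.
Proof. by congr wsum; apply/funext => s; rewrite mulrC. Qed.

Lemma wdotDl x y z : bounded_seq x -> bounded_seq y -> bounded_seq z ->
  wdot (fun s => x s + y s) z = wdot x z + wdot y z.
Proof.
move=> bx by_ bz; rewrite /wdot -wsumD; try exact: bounded_seqM.
by congr wsum; apply/funext => s; rewrite mulrDl.
Qed.

Lemma wdotZl a x z : bounded_seq x -> bounded_seq z ->
  wdot (fun s => a * x s) z = a * wdot x z.
Proof.
move=> bx bz; rewrite /wdot -wsumZ; last exact: bounded_seqM.
by congr wsum; apply/funext => s; rewrite mulrA.
Qed.

Lemma wdot_ge0 x : bounded_seq x -> 0 <= wdot x x.
Proof.
move=> bx; apply: wsum_ge0 => [|s]; first exact: bounded_seqM.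
by rewrite -expr2 sqr_ge0.
Qed.

Lemma wdot_le0 x : bounded_seq x -> wdot x x <= 0 -> forall s, x s = 0.
Proof.
move=> bx x0 s; have := wsum_ge_term _ s (bounded_seqM _ _ bx bx).
move=> /(_ (fun s => _)) h; have {}h := le_trans (h _) x0.
have /h : forall s, 0 <= x s * x s by move=> ?; rewrite -expr2 sqr_ge0.
rewrite pmulr_rle0 ?weight_gt0// -expr2 => xs0.
by apply/eqP; rewrite -sqrf_eq0 eq_le xs0 sqr_ge0.
Qed.

Lemma wnorm_ge0 x : 0 <= wnorm x.
Proof. exact: sqrtr_ge0. Qed.

Lemma wnorm_sqr x : bounded_seq x -> wnorm x ^+ 2 = wdot x x.
Proof. by move=> bx; rewrite sqr_sqrtr// wdot_ge0. Qed.

Lemma wnorm_eq0 x : bounded_seq x -> wnorm x = 0 -> forall s, x s = 0.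
Proof.
by move=> bx x0; apply: wdot_le0 => //; rewrite -wnorm_sqr// x0 expr0n.
Qed.

Lemma wnorm_le M x : bounded_by M x -> wnorm x <= M.
Proof.
move=> xM; have M0 : 0 <= M by exact: le_trans (xM 0%N).
rewrite -[leRHS]ger0_norm// -sqrtr_sqr ler_wsqrtr//.
apply: le_trans (ler_norm _) _; apply: wsum_le => s.
by rewrite normrM -expr2 lerXn2r// nnegrE.
Qed.

Lemma wnormZ a x : bounded_seq x -> wnorm (fun s => a * x s) = `|a| * wnorm x.
Proof.
move=> bx; rewrite /wnorm wdotZl//; last exact: bounded_seqZ.
rewrite wdotC wdotZl// mulrA -expr2 sqrtrM ?sqr_ge0//.
by rewrite sqrtr_sqr.
Qed.

(* Expand [wdot z z] for [z = b x - a y] with [a = wnorm x], [b = wnorm y]. *)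
Lemma wdot_cross x y : bounded_seq x -> bounded_seq y ->
  wdot (fun s => wnorm y * x s + (- wnorm x) * y s)
       (fun s => wnorm y * x s + (- wnorm x) * y s) =
  2 * (wnorm x * wnorm y) * (wnorm x * wnorm y - wdot x y).
Proof.
move=> bx by_; set a := wnorm x; set b := wnorm y.
have bbx := bounded_seqZ b _ bx; have bay := bounded_seqZ (- a) _ by_.
have bz := bounded_seqD _ _ bbx bay.
rewrite wdotDl// !wdotZl// ![wdot _ (fun s => _ + _)]wdotC !wdotDl// !wdotZl//.
by rewrite -!wnorm_sqr// -/a -/b (wdotC y x); ring.
Qed.

Lemma cauchy_schwarz x y : bounded_seq x -> bounded_seq y ->
  wdot x y <= wnorm x * wnorm y.
Proof.
move=> bx by_.
have wdot0 z t : (forall s, z s = 0) -> wdot z t = 0.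
  move=> z0; rewrite /wdot (_ : (fun s => _) = fun s => 0 * (fun=> 0) s).
    by rewrite wsumZ ?mul0r//; exists 0 => s; rewrite normr0.
  by apply/funext => s; rewrite z0 !mul0r.
(* The factor [2 * (wnorm x * wnorm y)] of [wdot_cross] can be cancelled only if it is positive, so
   vanishing norms are treated apart. *)
have [x0|x0] := eqVneq (wnorm x) 0.
  by rewrite x0 mul0r wdot0//; exact: wnorm_eq0.
have [y0|y0] := eqVneq (wnorm y) 0.
  by rewrite y0 mulr0 wdotC wdot0//; exact: wnorm_eq0.
have xy0 : 0 < wnorm x * wnorm y.
  by rewrite mulr_gt0// lt0r wnorm_ge0 ?x0 ?y0.
rewrite -subr_ge0 -(pmulr_rge0 _ (_ : 0 < 2 * (wnorm x * wnorm y))).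
  by rewrite -wdot_cross// wdot_ge0//; apply: bounded_seqD; apply: bounded_seqZ.
by rewrite mulr_gt0.
Qed.

Lemma wnormD_sqr x y : bounded_seq x -> bounded_seq y ->
  wnorm (fun s => x s + y s) ^+ 2 = wnorm x ^+ 2 + 2 * wdot x y + wnorm y ^+ 2.
Proof.
move=> bx by_; rewrite !wnorm_sqr//; last exact: bounded_seqD.
have bz := bounded_seqD _ _ bx by_.
by rewrite wdotDl// ![wdot _ (fun s => _ + _)]wdotC !wdotDl// (wdotC y x); ring.
Qed.

Lemma wnormD x y : bounded_seq x -> bounded_seq y ->
  wnorm (fun s => x s + y s) <= wnorm x + wnorm y.
Proof.
move=> bx by_; rewrite -(@ler_pXn2r _ 2)// ?nnegrE ?addr_ge0 ?wnorm_ge0//.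
rewrite wnormD_sqr// sqrrD lerD2r lerD2l -[leRHS]mulr_natl ler_wpM2l//.
exact: cauchy_schwarz.
Qed.

(** Equality in the triangle inequality forces equality in Cauchy-Schwarz; then [wdot_cross] shows
    that [wnorm y * x - wnorm x * y] has norm zero. *)
Lemma wnormD_eq x y : bounded_seq x -> bounded_seq y ->
  wnorm x + wnorm y <= wnorm (fun s => x s + y s) ->
  forall s, wnorm y * x s = wnorm x * y s.
Proof.
move=> bx by_; rewrite -(@ler_pXn2r _ 2)// ?nnegrE ?addr_ge0 ?wnorm_ge0//.
rewrite wnormD_sqr// sqrrD lerD2r lerD2l -mulr_natl ler_pM2l// => xy s.
have := @wdot_le0 (fun s => wnorm y * x s + (- wnorm x) * y s).
rewrite wdot_cross// => /(_ _ _ s) h; apply/eqP; rewrite -subr_eq0 -mulNr.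
apply/eqP/h; first by apply: bounded_seqD; apply: bounded_seqZ.
by rewrite mulr_ge0_le0 ?subr_le0// !mulr_ge0 ?wnorm_ge0.
Qed.

End WeightedSum.

(** * Branches of the binary tree and their separation at finite levels *)

Section Branches.
Implicit Types (f g : nat -> bool) (F G : seq (nat -> bool)) (s n : nat).

(* Nodes are finite bit strings, coded by natural numbers; a number that codes
   no node lies on no branch. *)
Definition on_branch f s : bool :=
  if unpickle s is Some c then c == mkseq f (size (c : seq bool)) else false.

Lemma take_mkseq f m n : (n <= m)%N -> take n (mkseq f m) = mkseq f n.
Proof. by move=> nm; rewrite /mkseq -map_take take_iota (minn_idPl nm). Qed.

Lemma eq_on_branch f g s (c : seq bool) n : unpickle s = Some c ->
  (size c <= n)%N -> mkseq f n = mkseq g n -> on_branch f s = on_branch g s.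
Proof.
move=> sc cn fg; rewrite /on_branch sc.
by rewrite -(take_mkseq f _ _ cn) -(take_mkseq g _ _ cn) fg.
Qed.

Lemma on_branch_take f s (c : seq bool) n : unpickle s = Some c ->
  (n <= size c)%N -> on_branch f s -> take n c = mkseq f n.
Proof. by move=> sc nc; rewrite /on_branch sc => /eqP ->; exact: take_mkseq. Qed.

Lemma mkseq_separates f g : f <> g ->
  \forall n \near \oo, mkseq f n != mkseq g n.
Proof.
move=> fg; have [k fgk] : exists k, f k <> g k.
  by apply/existsNP => fg'; apply: fg; apply/funext.
exists k.+1 => // n /= kn; apply/eqP => /(congr1 (fun c => nth false c k)).
by rewrite !nth_mkseq.
Qed.

Lemma uniq_mkseq F : uniq F ->
  \forall n \near \oo, uniq [seq mkseq f n | f <- F].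
Proof.
elim: F => [_|f F IH /=]; first by apply: nearW.
move=> /andP[fF /IH {}IH].
suff : \forall n \near \oo, mkseq f n \notin [seq mkseq g n | g <- F].
  by move=> H; near=> n; apply/andP; split; near: n.
elim: F fF {IH} => [_|g F IH]; first by apply: nearW.
rewrite inE negb_or => /andP[/eqP fg /IH {}IH].
have fgn := mkseq_separates _ _ fg.
near=> n; rewrite /= inE negb_or; apply/andP.
by split; near: n.
Unshelve. all: by end_near. Qed.

End Branches.

(** * Johnson-Lindenstrauss sequences and their approximation by countably many data *)

Section JohnsonLindenstrauss.
Variable R : realType.
Implicit Types (f g : nat -> bool) (F G : seq (nat -> bool)) (s n : nat).
Implicit Types (x y : nat -> R) (a b : nat -> R) (t : seq (R * (nat -> bool))).

(** Coefficients are indexed by position, not by branch, so that two families of branches can share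
    the same coefficients. *)
Definition comb a F s : R :=
  \sum_(i < size F) a i * (on_branch (nth (fun=> false) F i) s)%:R.

(** The first [n] bits of the node single out the only branch of [F] that may pass through it. The
    value is expressed by these bits alone, hence agrees for two families with equal prefixes. *)
Lemma comb_high a F s (c : seq bool) n : unpickle s = Some c ->
  (n <= size c)%N -> uniq [seq mkseq f n | f <- F] ->
  comb a F s = 0 \/
  comb a F s = a (index (take n c) [seq mkseq f n | f <- F]).
Proof.
move=> sc nc uF; pose o i := on_branch (nth (fun=> false) F i) s.
have oi i : (i < size F)%N -> o i ->
    index (take n c) [seq mkseq f n | f <- F] = i.
  move=> iF /(on_branch_take _ _ _ _ sc nc) ->.
  rewrite -(nth_map _ [::] (fun f => mkseq f n))//.
  by rewrite index_uniq// size_map.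
have [/existsP[i oFi]|] := boolP [exists i : 'I_(size F), o i].
  right; rewrite /comb (bigD1 i)//= -/(o i) oFi mulr1 big1 ?addr0.
    by rewrite (oi i).
  move=> j ji; rewrite -/(o j); case oj: (o j); last by rewrite mulr0.
  by case/eqP: ji; apply/val_inj; rewrite /= -(oi i)// (oi j).
rewrite negb_exists => /forallP oF; left; apply: big1 => i _.
by rewrite -/(o i) (negbTE (oF i)) mulr0.
Qed.

(* Below level [n] the two families of branches coincide, and a node above
   level [n] lies on at most one branch of each family, with the same index. *)
Lemma comb_cases a F G n s : uniq [seq mkseq f n | f <- F] ->
  [seq mkseq f n | f <- F] = [seq mkseq f n | f <- G] ->
  [\/ comb a F s = comb a G s, comb a F s = 0 | comb a G s = 0].
Proof.
move=> uF FG.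
have sFG : size F = size G by have := congr1 size FG; rewrite !size_map.
case sc: (unpickle s : option (seq bool)) => [c|]; last first.
  have comb0 H : comb a H s = 0.
    by apply: big1 => i _; rewrite /on_branch sc mulr0.
  by apply: Or32.
have [cn|/ltnW nc] := leqP (size c) n.
  apply: Or31; rewrite /comb sFG; apply: eq_bigr => i _; congr (_ * _%:R).
  apply/(congr1 nat_of_bool)/(eq_on_branch _ _ _ _ n sc cn).
  rewrite -!(nth_map _ [::] (fun f => mkseq f n)) ?FG//.
  by rewrite sFG.
have [->|hF] := comb_high a F s c n sc nc uF; first exact: Or32.
have [->|hG] := comb_high a G s c n sc nc (etrans (congr1 uniq (esym FG)) uF).
  exact: Or33.
by apply: Or31; rewrite hF hG FG.
Qed.

Definition lin_comb t s : R := \sum_(p <- t) p.1 * (on_branch p.2 s)%:R.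

(** Controlling only late entries means approximating uniformly up to a finitely supported sequence;
    this gives the closure of c_0 plus the span of the branch indicators. *)
Definition JLpred : {pred nat -> R} := [pred x | `[< forall d : R, 0 < d ->
  exists t, \forall s \near \oo, `|x s - lin_comb t s| <= d >]].

(** Terms on the same branch are collected, because only distinct branches have distinct prefixes at
    some level. *)
Lemma lin_comb_uniq t : exists a F, uniq F /\ lin_comb t = comb a F.
Proof.
pose F := undup (map snd t); pose b f := \sum_(p <- t | p.2 == f) p.1.
exists (fun i => b (nth (fun=> false) F i)), F; split; first exact: undup_uniq.
apply/funext => s; transitivity
  (\sum_(f <- F) b f * (on_branch f s)%:R); last first.
  by rewrite (big_nth (fun=> false)) big_mkord.
under [RHS]eq_bigr do rewrite big_distrl/= big_mkcond.
rewrite exchange_big/= /lin_comb !big_seq; apply: eq_bigr => p pt.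
rewrite -big_mkcond/= (eq_bigl (pred1 p.2)); last by move=> f; rewrite /= eq_sym.
by rewrite -big_filter filter_pred1_uniq ?undup_uniq ?big_seq1// mem_undup map_f.
Qed.

Lemma rat_approx (r e : R) : 0 < e -> exists q : rat, `|r - ratr q| <= e.
Proof.
move=> e0; have /rat_in_itvoo[q] : r - e < r + e by rewrite ltrD2l gtrN.
by rewrite in_itv/= => /andP[q1 q2]; exists q; rewrite ler_distlC !ltW.
Qed.

(** The components are rational values of the initial entries, rational coefficients, a separating
    level, and the prefixes of the branches at that level. The branches themselves are left out to
    keep the type countable. *)
Definition datum : countType := (seq rat * seq rat * nat * seq (seq bool))%type.

Definition approximates (e : R) x (d : datum) : Prop :=
  let: (u, q, n, c) := d in
  exists F, [/\ [seq mkseq f n | f <- F] = c, uniq c,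
    forall s, (s < size u)%N -> `|x s - ratr u`_s| <= e &
    forall s, (size u <= s)%N -> `|x s - comb (fun i => ratr q`_i) F s| <= e].

Lemma approximates_ex (e : R) x N : x \in JLpred -> 0 < e ->
  exists2 d : datum, approximates e x d & (N <= size d.1.1.1)%N.
Proof.
move=> /asboolP Px e0; have e20 : 0 < e / 2 by lra.
have [t [N0 _ xt]] := Px _ e20.
have [a [F [uF tF]]] := lin_comb_uniq t.
have [n _ /(_ n (leqnn n)) un] := uniq_mkseq _ uF.
(* The errors of the [k] coefficients add up to at most [e / 2]; dividing by [k.+1] keeps the
   tolerance positive for an empty family. *)
pose k := size F; have ek : 0 < e / 2 / k.+1%:R by rewrite divr_gt0.
have [q aq] := choice (fun r : R => rat_approx r _ ek).
have [u xu] := choice (fun r : R => rat_approx r _ e0).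
pose M := maxn N N0.
exists (mkseq (fun s => u (x s)) M, mkseq (fun i => q (a i)) k, n,
  [seq mkseq f n | f <- F]); last by rewrite /= size_mkseq leq_maxl.
exists F; split=> //=; rewrite size_mkseq => s sM.
  by rewrite nth_mkseq.
rewrite -[x s](subrK (lin_comb t s)) -addrA.
apply: (le_trans (ler_normD _ _)); rewrite [leRHS](splitr e) lerD//.
  by apply: xt; apply: leq_trans sM; rewrite leq_maxr.
rewrite tF /comb -sumrB; apply: (le_trans (ler_norm_sum _ _ _)).
apply: (@le_trans _ _ (\sum_(i < k) e / 2 / k.+1%:R)).
  apply: ler_sum => i _; rewrite nth_mkseq// -mulrBl normrM.
  rewrite -[leRHS]mulr1 ler_pM//.
  by rewrite ger0_norm ?ler0n// lern1; case: (on_branch _ _).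
rewrite sumr_const card_ord -[leLHS]mulr_natr -mulrA ler_piMr ?ltW//.
by rewrite mulrC ltr_pdivrMr// mul1r ltr_nat.
Qed.

(** Past the recorded entries [comb_cases] applies: either both combinations agree and the entries
    differ by at most [2 * e], or one vanishes, so that one entry is at most [e] and the other at
    most [M] in absolute value. *)
Lemma approximates_close (e M : R) x y (d : datum) : approximates e x d ->
  approximates e y d -> bounded_by R M x -> bounded_by R M y ->
  (forall s, (s < size d.1.1.1)%N -> `|x s - y s| <= 2 * e) /\
  (forall s, `|x s - y s| <= M + 3 * e).
Proof.
case: d => [[[u q] n] c] [F [Fc uc xu xF]] [G [Gc _ yu yG]] xM yM /=.
have M0 : 0 <= M by exact: le_trans (xM 0%N).
have low s : (s < size u)%N -> `|x s - y s| <= 2 * e.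
  move=> su; have := xu _ su; have := yu _ su; rewrite !ler_norml.
  by move=> /andP[? ?] /andP[? ?]; apply/andP; split; lra.
split=> // s; have [/low h|us] := ltnP s (size u).
  by apply: (le_trans h); have := le_trans (normr_ge0 _) h; lra.
have := xF _ us; have := yG _ us; have := xM s; have := yM s.
have uF : uniq [seq mkseq f n | f <- F] by rewrite Fc.
have := comb_cases (fun i => ratr q`_i) F G n s uF (etrans Fc (esym Gc)).
move: (comb _ F s) (comb _ G s) => X Y XY.
rewrite !ler_norml => /andP[? ?] /andP[? ?] /andP[? ?] /andP[? ?].
by apply/andP; split; case: XY => XY; lra.
Qed.

Lemma bounded_near (M : R) x :
  (\forall s \near \oo, `|x s| <= M) -> bounded_seq R x.
Proof.
move=> [N _ xM]; exists (`|M| + \sum_(k < N) `|x k|) => s.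
have [sN|Ns] := ltnP s N.
  rewrite -[leLHS]add0r lerD// (bigD1 (Ordinal sN))//= lerDl.
  by apply: sumr_ge0.
rewrite -[leLHS]addr0 lerD// ?sumr_ge0//.
by apply: le_trans (ler_norm _); exact: xM.
Qed.

Lemma lin_comb_bounded t : bounded_seq R (lin_comb t).
Proof.
exists (\sum_(p <- t) `|p.1|) => s; apply: (le_trans (ler_norm_sum _ _ _)).
apply: ler_sum => p _; rewrite normrM ler_piMr// ger0_norm ?ler0n//.
by rewrite lern1; case: (on_branch _ _).
Qed.

Lemma JLpred_bounded x : x \in JLpred -> bounded_seq R x.
Proof.
move=> /asboolP /(_ 1 ltr01)[t xt]; have [M tM] := lin_comb_bounded t.
apply: (bounded_near (1 + M)); apply: filterS xt => s xts.
rewrite -[x s](subrK (lin_comb t s)).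
by apply: (le_trans (ler_normD _ _)); rewrite lerD.
Qed.

Lemma JLpred_closed : submod_closed JLpred.
Proof.
split.
  apply/asboolP => d d0; exists [::]; apply: nearW => s.
  by rewrite /lin_comb big_nil subr0 normr0 ltW.
move=> k x y /asboolP Px /asboolP Py; apply/asboolP => d d0.
(* Adding 1 allows division also when [k = 0]. *)
have k1 : 0 < `|k| + 1 by rewrite ltr_wpDl.
have d1 : 0 < d / 2 / (`|k| + 1) by rewrite !divr_gt0.
have [t xt] := Px _ d1; have [t' yt'] := Py _ (divr_gt0 d0 (ltr0Sn R 1)).
exists ([seq (k * p.1, p.2) | p <- t] ++ t'); near=> s.
have -> : lin_comb ([seq (k * p.1, p.2) | p <- t] ++ t') s =
    k * lin_comb t s + lin_comb t' s.
  rewrite /lin_comb big_cat big_map/= big_distrr/=; congr (_ + _).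
  by apply: eq_bigr => p _; rewrite mulrA.
have -> : (k *: x + y) s - (k * lin_comb t s + lin_comb t' s) =
    k * (x s - lin_comb t s) + (y s - lin_comb t' s).
  by rewrite -[(k *: x + y) s]/(k * x s + y s); ring.
apply: (le_trans (ler_normD _ _)); rewrite [leRHS](splitr d) lerD//.
  rewrite normrM; apply: (@le_trans _ _ ((`|k| + 1) * (d / 2 / (`|k| + 1)))).
    by rewrite ler_pM// ?lerDl//; near: s.
  by rewrite mulrC divfK// gt_eqF.
by near: s.
Unshelve. all: by end_near. Qed.

Lemma JLpred_lim x : (forall e, 0 < e -> exists2 y, y \in JLpred &
  bounded_by R e (fun s => x s - y s)) -> x \in JLpred.
Proof.
move=> xP; apply/asboolP => d d0; have d20 : 0 < d / 2 by lra.
have [y /asboolP Py xy] := xP _ d20; have [t yt] := Py _ d20.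
exists t; apply: filterS yt => s yts.
rewrite -[x s](subrK (y s)) -addrA [leRHS](splitr d).
by apply: (le_trans (ler_normD _ _)); rewrite lerD.
Qed.

Lemma branch_JLpred f : (fun s => (on_branch f s)%:R) \in JLpred.
Proof.
apply/asboolP => d d0; exists [:: (1, f)]; apply: nearW => s.
by rewrite /lin_comb big_seq1 mul1r subrr normr0 ltW.
Qed.

End JohnsonLindenstrauss.

(** * The supremum norm and the strictly convex norm built on it *)

Section SupNorm.
Variable R : realType.
Implicit Types (x y : nat -> R) (M : R).

Definition supnorm x : R := sup (range (fun s => `|x s|)).

Lemma supnorm_le M x : bounded_by R M x -> supnorm x <= M.
Proof.
by move=> xM; apply: ge_sup; [exists `|x 0%N|, 0%N | move=> _ [s _ <-]; exact: xM].
Qed.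

Lemma supnorm_ge x : bounded_seq R x -> bounded_by R (supnorm x) x.
Proof.
move=> [M xM] s; apply: ub_le_sup; last by exists s.
by exists M => _ [k _ <-]; exact: xM.
Qed.

Lemma supnorm_ge0 x : bounded_seq R x -> 0 <= supnorm x.
Proof. by move=> bx; apply: le_trans (supnorm_ge _ bx 0%N). Qed.

Lemma supnormD x y : bounded_seq R x -> bounded_seq R y ->
  supnorm (fun s => x s + y s) <= supnorm x + supnorm y.
Proof.
move=> bx by_; apply: supnorm_le => s.
by apply: (le_trans (ler_normD _ _)); rewrite lerD// supnorm_ge.
Qed.

Lemma supnormZ (k : R) x : bounded_seq R x ->
  supnorm (fun s => k * x s) = `|k| * supnorm x.
Proof.
(* For nonzero [k], the reverse inequality is this one for the scalar [k^-1] and the sequence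
   [k * x]. *)
have half j y : bounded_seq R y -> supnorm (fun s => j * y s) <= `|j| * supnorm y.
  move=> by_; apply: supnorm_le => s.
  by rewrite normrM ler_wpM2l// supnorm_ge.
move=> bx; apply/eqP; rewrite eq_le half//=.
have [->|k0] := eqVneq k 0.
  by rewrite normr0 mul0r supnorm_ge0//; exact: bounded_seqZ.
rewrite mulrC -ler_pdivlMr ?normr_gt0// mulrC -normfV.
have := half k^-1 _ (bounded_seqZ _ k _ bx).
by under [in leLHS]eq_fun do rewrite mulKf//.
Qed.

Definition JLnorm x : R := supnorm x + wnorm R x.

Lemma JLnorm_le M x : bounded_by R M x -> JLnorm x <= 2 * M.
Proof.
by move=> xM; rewrite mulr_natl mulr2n lerD ?supnorm_le ?wnorm_le.
Qed.

Lemma JLnorm_ge x s : bounded_seq R x -> `|x s| <= JLnorm x.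
Proof.
move=> bx; rewrite -[leLHS]addr0 lerD ?wnorm_ge0//.
exact: supnorm_ge.
Qed.

End SupNorm.

(** * The Banach space: completeness and strict convexity *)

Section JLspace.
Variable R : realType.

HB.instance Definition _ := GRing.isSubmodClosed.Build R (nat -> R)
  (JLpred R) (JLpred_closed R).

Record JL := MkJL { JLval :> nat -> R; _ : JLval \in JLpred R }.

HB.instance Definition _ := [isSub for JLval].
HB.instance Definition _ := [Choice of JL by <:].
HB.instance Definition _ := [SubChoice_isSubLmodule of JL by <:].

Lemma JLP (x : JL) : JLval x \in JLpred R. Proof. exact: valP. Qed.

Lemma JL_bounded (x : JL) : bounded_seq R x.
Proof. exact/JLpred_bounded/JLP. Qed.

Lemma JL_eqP (x y : JL) : (forall s, x s = y s) -> x = y.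
Proof. by move=> xy; apply/val_inj/funext. Qed.

Let N (x : JL) := JLnorm R x.

Lemma JLnormD (x y : JL) : N (x + y) <= N x + N y.
Proof.
rewrite /N /JLnorm addrACA lerD//.
  by apply: supnormD; exact: JL_bounded.
by apply: wnormD; exact: JL_bounded.
Qed.

Lemma JLnormZ (k : R) (x : JL) : N (k *: x) = `|k| * N x.
Proof.
rewrite /N /JLnorm mulrDr; congr (_ + _).
  by apply: supnormZ; exact: JL_bounded.
by apply: wnormZ; exact: JL_bounded.
Qed.

Lemma JLnorm0_eq0 (x : JL) : N x = 0 -> x = 0.
Proof.
move=> x0; apply: JL_eqP => s; apply/eqP; rewrite -normr_le0 -x0.
by apply: JLnorm_ge; exact: JL_bounded.
Qed.

HB.instance Definition _ := Lmodule_isNormed.Build R JL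
  JLnormD JLnormZ JLnorm0_eq0.

Lemma JL_normE (x : JL) : `|x| = supnorm R x + wnorm R x.
Proof. by []. Qed.

Lemma JL_norm_ge (x : JL) s : `|x s| <= `|x|.
Proof. by apply: JLnorm_ge; exact: JL_bounded. Qed.

Lemma JL_norm_le M (x : JL) : bounded_by R M x -> `|x| <= 2 * M.
Proof. exact: JLnorm_le. Qed.

Lemma JL_complete (F : set_system JL) : ProperFilter F -> cauchy F -> cvg F.
Proof.
move=> FF /cauchyP cF.
have cs s : cvg ((fun z : JL => z s) @ F).
  apply: R_complete; apply/cauchy_exP => e /cF[x xF]; exists (x s) => /=.
  apply: filterS xF => z; rewrite -!ball_normE/=; apply: le_lt_trans.
  exact: (JL_norm_ge (x - z)).
pose l s := lim ((fun z : JL => z s) @ F).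
(* The limit [l] is only coordinatewise, but a ball belonging to the filter bounds all coordinates
   at once. *)
have near_l e (y : JL) : 0 < e -> F (ball y e) ->
    bounded_by R e (fun s => l s - y s).
  move=> e0 yF s; apply/ler_addgt0Pr => d d0.
  have /cvgrPdist_le/(_ _ d0) lF := cs s.
  have [z [lz]] := @filter_ex _ F FF _ (filterI lF yF).
  rewrite -ball_normE/= => yz; rewrite -[l s](subrK (z s)) -addrA.
  apply: (le_trans (ler_normD _ _)); rewrite [leRHS]addrC lerD//.
  apply: le_trans (ltW yz); rewrite distrC.
  exact: (JL_norm_ge (y - z)).
have lP : l \in JLpred R.
  apply: JLpred_lim => e e0; have [y yF] := cF _ e0.
  by exists y; [exact: JLP | exact: near_l].
apply/cvg_ex; exists (MkJL l lP); apply/cvgrPdist_le => e e0.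
(* One quarter is spent from [l] to [y] and one from [y] to [z]; [JL_norm_le] doubles their sum. *)
have e40 : 0 < e / 4 by lra.
have [y yF] := cF _ e40; apply: filterS (yF) => z.
rewrite -ball_normE/= => yz; have -> : e = 2 * (e / 4 + e / 4) by lra.
apply: JL_norm_le => s; rewrite -[leLHS]/`|l s - z s|.
rewrite -[l s](subrK (y s)) -addrA.
apply: (le_trans (ler_normD _ _)); rewrite lerD//.
  exact: (near_l _ _ e40 yF).
by apply: le_trans (ltW yz); exact: (JL_norm_ge (y - z)).
Qed.

HB.instance Definition _ := Uniform_isComplete.Build JL JL_complete.

(** Both summands of the norm obey the triangle inequality, so equality for the norm gives equality
    for [wnorm], and [wnormD_eq] makes the vectors proportional. *)
Lemma JL_strictly_convex : @strictly_convex R JL.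
Proof.
move=> x y x0 y0 xy.
have bx := JL_bounded x; have by_ := JL_bounded y.
have wpos (z : JL) : z != 0 -> 0 < wnorm R z.
  move=> z0; rewrite lt0r wnorm_ge0 andbT; apply: contra z0 => /eqP z0.
  by apply/eqP/JL_eqP => s; rewrite (wnorm_eq0 _ _ (JL_bounded z) z0).
have wx := wpos _ x0; have wy := wpos _ y0.
have : wnorm R x + wnorm R y <= wnorm R (fun s => x s + y s).
  have := supnormD _ _ _ bx by_; move: xy; rewrite !JL_normE.
  rewrite -[JLval (x + y)]/(fun s => x s + y s); lra.
move=> /(wnormD_eq _ _ _ bx by_) h.
exists (wnorm R x / wnorm R y); first by rewrite divr_gt0.
apply: JL_eqP => s; rewrite -[RHS]/(wnorm R x / wnorm R y * y s).
by rewrite mulrAC -h mulrAC divff ?mul1r// gt_eqF.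
Qed.

End JLspace.

(** * Cardinality and density of the space *)

Section Cardinalities.
Variable R : realType.

(* Ternary expansions with digits 0 and 2, i.e. the Cantor set. *)
Definition cantor_real (b : nat -> bool) : R := wsum R (fun s => (b s)%:R).

Lemma bounded_bool (b : nat -> bool) : bounded_by R 1 (fun s => (b s)%:R).
Proof. by move=> s; rewrite ger0_norm ?ler0n// lern1; case: (b s). Qed.

(** At the first differing digit [k] the sums change by 2/3^(k+1), while all later digits together
    change them by at most 1/3^(k+1). *)
Lemma cantor_real_inj : injective cantor_real.
Proof.
move=> b b' bb'; apply/funext; apply: contrapT => /existsNP[k0 /eqP bk0].
have [k /eqP bk kmin] := ex_minnP (ex_intro (fun k => b k != b' k) _ bk0).
pose z s : R := (b s)%:R + (-1) * (b' s)%:R.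
have bnd (c : nat -> bool) : bounded_seq R (fun s => (c s)%:R).
  by exists 1; exact: bounded_bool.
have z0 : wsum R z = 0.
  rewrite wsumD ?wsumZ//; last exact: bounded_seqZ.
  by rewrite mulN1r; apply/eqP; rewrite subr_eq0; apply/eqP.
have zb : bounded_by R 1 z.
  by move=> s; rewrite /z; case: (b s); case: (b' s) => /=;
    rewrite ler_norml; apply/andP; split; lra.
have := wsum_tail _ _ _ k.+1 zb; rewrite z0 big_nat_recr//= big_nat big1.
  have t0 : 0 < (3 ^+ k.+1)^-1 :> R by rewrite invr_gt0 exprn_gt0.
  rewrite !add0r normrN mul1r normrM gtr0_norm ?weight_gt0// /weight /z.
  suff -> : `|(b k)%:R + -1 * (b' k)%:R| = 1 :> R by lra.
  move: bk; case: (b k); case: (b' k) => // _.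
    by rewrite mulr0 addr0 normr1.
  by rewrite add0r mulN1r normrN normr1.
move=> s /= sk; have : ~~ (b s != b' s).
  by apply/negP => /kmin; rewrite leqNgt sk.
by rewrite negbK => /eqP bs; rewrite /z bs mulN1r subrr mulr0.
Qed.

(** The Dedekind cut of [r] as a bit sequence, which also serves as a branch; it provides continuum
    many branches. *)
Definition cut (r : R) (n : nat) : bool :=
  if unpickle n is Some q then ratr (q : rat) < r else false.

Lemma cut_inj : injective cut.
Proof.
have half r r' : cut r = cut r' -> r <= r'.
  move=> rr'; rewrite leNgt; apply/negP => /rat_in_itvoo[q].
  rewrite in_itv/= => /andP[q1 q2]; have := congr1 (fun c => c (pickle q)) rr'.
  by rewrite /cut pickleK q2 ltNge (ltW q1).
by move=> r r' rr'; apply/eqP; rewrite eq_le !half.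
Qed.

(** The cuts of all entries are interleaved into one bit sequence, which the Cantor set turns into
    one real. *)
Lemma card_JL : [set: JL R] #<= [set: R].
Proof.
pose h (x : JL R) (n : nat) : bool :=
  if unpickle n is Some p then cut (x (p : nat * nat).1) p.2 else false.
apply/pcard_injP; exists (cantor_real \o h) => x y _ _ /cantor_real_inj hxy.
apply: JL_eqP => s; apply: cut_inj; apply/funext => n.
by have := congr1 (fun c => c (pickle (s, n))) hxy; rewrite /h pickleK.
Qed.

Definition branch_vector (f : nat -> bool) : JL R := MkJL R _ (branch_JLpred R f).

Lemma branch_vector_dist f g : f <> g ->
  1 <= `|branch_vector f - branch_vector g|.
Proof.
move=> fg; have [n _ /(_ n (leqnn n)) fgn] := mkseq_separates _ _ fg.
have := JL_norm_ge _ (branch_vector f - branch_vector g) (pickle (mkseq f n)).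
apply: le_trans; rewrite -[leRHS]/`|_%:R - _%:R|.
by rewrite /on_branch !pickleK size_mkseq eqxx (negbTE fgn) subr0 normr1.
Qed.

Lemma JL_density : has_density (JL R) R.
Proof.
have lower (D : set (JL R)) : dense D -> [set: R] #<= D.
  (* Branch vectors of distinct reals are at distance at least 1, so their open balls of radius 1/2
     are disjoint and picking a point of [D] in each is injective. *)
  move=> dD; have /choice[h hP] (r : R) :
      exists d, D d /\ ball (branch_vector (cut r)) 2^-1 d.
    have [|d [bd Dd]] := dD (ball (branch_vector (cut r)) 2^-1) _ (ball_open _ _).
      by exists (branch_vector (cut r)); exact: ballxx.
    by exists d.
  apply/pcard_leP/injfunPex; exists h => [r _|r r' _ _ hrr']; first by case: (hP r).
  apply: cut_inj; apply: contrapT => /branch_vector_dist; apply/negP.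
  rewrite -ltNge; have [_] := hP r; have [_] := hP r'; rewrite -hrr' -!ball_normE/=.
  move=> h1 h2.
  have := ler_distD (h r) (branch_vector (cut r)) (branch_vector (cut r')).
  rewrite (distrC (h r)); lra.
have dT : dense [set: JL R] by move=> O O0 _; rewrite setIT.
split=> //; exists [set: JL R]; split => //.
by rewrite card_eq_le card_JL lower.
Qed.

End Cardinalities.

(** * A countable pigeonhole principle for regular cardinals *)

Lemma well_order_total (K : Type) (le : rel K) : wochoice.well_order le ->
  forall x y, le x y || le y x.
Proof.
move=> wo x y.
have ne : wochoice.nonempty (fun z => `[< z = x \/ z = y >]).
  by exists x; apply/asboolP; left.
have [z [[/asboolP zxy zmin] _]] := wo _ ne.
have zx : le z x by apply: zmin; apply/asboolP; left.
have zy : le z y by apply: zmin; apply/asboolP; right.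
by case: zxy => <-; rewrite ?zx ?zy ?orbT.
Qed.

(** Transport [Y] to [K]. If no [Z i] were cofinal there, choosing a bound for each [i] would give a
    countable cofinal set, which regularity makes as large as the uncountable [K]. *)
Lemma regular_pigeonhole (K : Type) (T : pointedType) (I : countType) (Y : set T)
    (Z : I -> set T) :
  uncountable_cardinal K -> regular_cardinal K -> Y #= [set: K] ->
  Y `<=` \bigcup_i Z i -> exists i, Y `&` Z i #= [set: K].
Proof.
move=> uK [_ [le [[wo _] reg]]] YK YZ; have tot := well_order_total _ _ wo.
have [g [gY ginj gsurj]] : exists g : K -> T, set_bij [set: K] Y g.
  by apply/card_set_bijP; rewrite card_eq_sym.
have [i Ci] : exists i, cofinal le [set k | Z i (g k)].
  apply: contrapT => /forallNP nC.
  have /choice[h hP] i : exists k, forall k', Z i (g k') -> ~ le k k'.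
    by have /existsNP[k kP] := nC i; exists k => k' Zk' kk'; apply: kP; exists k'.
  have hc : ~ cofinal le (range h).
    move=> /reg hK; apply: uK; rewrite -(eq_countable hK).
    exact: card_le_trans (card_image_le _ _) (countableP _).
  apply: hc => k; have [i _ Zi] := YZ _ (gY k Logic.I).
  exists (h i); first by exists i.
  by have := tot k (h i); case/orP => // /(hP _ _ Zi).
exists i; apply: card_eq_trans (reg _ Ci).
have -> : Y `&` Z i = g @` [set k | Z i (g k)].
  apply/seteqP; split=> [y [Yy Zy]|_ [k Zk <-]].
    by have [k _ gk] := gsurj _ Yy; exists k; rewrite //= gk.
  by split=> //; exact: gY.
by apply: inj_card_eq => k k' _ _; apply: ginj; rewrite inE.
Qed.

(** * Countable decomposition of the unit sphere into concentrated pieces *)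

Section SpherePieces.
Variable R : realType.

(** With e = 1/(j+1), the lower bound on [wnorm] caps the sup norm by 1 - e, and the last condition
    makes the weights past the recorded entries negligible. *)
Definition piece (p : nat * datum) : set (JL R) :=
  [set x : JL R | [/\ `|x| = 1, p.1.+1%:R^-1 <= wnorm R x,
    approximates R (p.1.+1%:R^-1 / 16) x p.2 &
    4 * (3 ^+ size p.2.1.1.1)^-1 <= p.1.+1%:R^-1 ^+ 2 / 64 :> R]].

Lemma sphere_pieces : unit_sphere (JL R) `<=` \bigcup_p piece p.
Proof.
move=> x /= x1.
have wx : 0 < wnorm R x.
  rewrite lt0r wnorm_ge0 andbT; apply/eqP => w0.
  have x0 : x = 0 by apply: JL_eqP; exact: wnorm_eq0 (JL_bounded _ x) w0.
  by move: x1; rewrite x0 /unit_sphere /= normr0 => /eqP; rewrite eq_sym oner_eq0.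
have [j _ /(_ j (leqnn j)) jx] := near_infty_natSinv_lt (PosNum wx).
set e : R := j.+1%:R^-1 in jx; have e0 : 0 < e by rewrite invr_gt0.
have e2 : 0 < e ^+ 2 / 64 / 4 by rewrite !divr_gt0// exprn_gt0.
have [N _ NP] : \forall n \near \oo, (3 ^+ n)^-1 <= e ^+ 2 / 64 / 4.
  have /(cvg_geometric 1)/cvgrPdist_le/(_ _ e2) : `|3^-1 : R| < 1.
    by rewrite gtr0_norm; lra.
  apply: filterS => n; rewrite sub0r normrN /= mul1r exprVn => H.
  exact: le_trans (ler_norm _) H.
have e16 : 0 < e / 16 by lra.
have [d xd Nd] := approximates_ex _ _ _ N (JLP _ x) e16.
exists (j, d) => //; split => //=; first exact: ltW.
by have := NP _ Nd; rewrite -/e; lra.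
Qed.

(** The difference has sup norm at most [1 - e + 3 * (e / 16)] and weighted norm at most [e / 4], in
    total 1 - 9e/16. *)
Lemma piece_concentrated p : concentrated (1 - p.1.+1%:R^-1 / 2) (piece p).
Proof.
case: p => j d x y [/= x1 ex xd Nd] [/= y1 ey yd _] _.
set e : R := j.+1%:R^-1 in ex xd Nd ey yd *.
have e0 : 0 < e by rewrite invr_gt0.
have sup_le (z : JL R) : `|z| = 1 -> e <= wnorm R z -> bounded_by R (1 - e) z.
  move=> z1 ez s; apply: le_trans (supnorm_ge _ _ (JL_bounded _ z) s) _.
  by have := JL_normE _ z; rewrite z1; lra.
have [low all] := approximates_close _ _ _ _ _ _ xd yd
  (sup_le _ x1 ex) (sup_le _ y1 ey).
have e1 : e <= 1 by rewrite invf_le1// ler1n.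
rewrite JL_normE; have bz := JL_bounded _ (x - y).
have s1 : supnorm R (x - y) <= 1 - e + 3 * (e / 16) by exact: supnorm_le.
suff : wnorm R (x - y) <= e / 4 by lra.
rewrite -(@ler_pXn2r _ 2)// ?nnegrE ?wnorm_ge0//; last by lra.
rewrite wnorm_sqr//; apply: le_trans (ler_norm _) _.
(* Recorded entries differ by at most e/8, with square e^2/64. Other entries differ by at most 2,
   with square 4, and their weights reduce this to e^2/64. The total e^2/32 is below (e/4)^2. *)
have := wsum_le_split R ((2 * (e / 16)) ^+ 2) 4 (fun s => (x - y) s * (x - y) s)
  (size d.1.1.1).
move=> /(_ (sqr_ge0 _)) h; apply: le_trans (h _ _) _.
- by move=> s /low xys; rewrite normrM -expr2 lerXn2r ?nnegrE//; lra.
- move=> s; have -> : 4 = 2 * 2 :> R by lra.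
  rewrite normrM; have : `|(x - y) s| <= 2.
    by apply: le_trans (all s) _; lra.
  by move=> xy2; rewrite ler_pM.
- by move: Nd; have := sqr_ge0 e; rewrite !expr2; lra.
Qed.

End SpherePieces.

Theorem theorem1 (R : realType) :
  exists X : completeNormedModType R,
    [/\ strictly_convex X,
        has_density X R &
        forall K : Type, uncountable_cardinal K -> regular_cardinal K ->
        forall Y : set X, Y `<=` unit_sphere X -> Y #= [set: K] ->
        exists (eps : R) (Y' : set X),
          [/\ 0 < eps, Y' `<=` Y, Y' #= [set: K] & concentrated (1 - eps) Y']].
Proof.
exists (JL R); split; [exact: JL_strictly_convex|exact: JL_density|].
move=> K uK rK Y Ysphere YK.
have YZ : Y `<=` \bigcup_p piece R p by move=> y /Ysphere /sphere_pieces.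
have [p Yp] := regular_pigeonhole _ _ _ _ _ uK rK YK YZ.
exists (p.1.+1%:R^-1 / 2), (Y `&` piece R p); split=> //.
by move=> y y' [_ py] [_ py']; exact: piece_concentrated.
Qed.
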